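(* Let $\tau$ and $\tau'$ be topologies on a set $X$ such that $(X,\tau)$ is quasi-Polish, $(X,\tau')$ is separable and metrizable, and $\tau\subseteq\tau'\subseteq\mathbf{\Sigma}^0_2(X,\tau)$. Then $(X,\tau')$ is Polish.
   Context: $\mathbf{\Sigma}^0_2(X,\tau)$ is the family of all sets of the form $\bigcup_{i\in\omega}(U_i\setminus V_i)$ with $U_i,V_i\in\tau$. A quasi-metric on a set $X$ is a function $d\colon X\times X\to[0,\infty)$ with $x=y$ iff $d(x,y)=d(y,x)=0$ and $d(x,z)\le d(x,y)+d(y,z)$; it induces the topology generated by $B_d(x,\varepsilon)=\{y\mid d(x,y)<\varepsilon\}$; $\widehat d(x,y)=\max\{d(x,y),d(y,x)\}$. $(x_n)$ is Cauchy if for every $\varepsilon>0$ there is $n_0$ with $d(x_n,x_m)<\varepsilon$ for all $m\ge n\ge n_0$; $d$ is complete if every Cauchy sequence converges in the topology of $\widehat d$. A space is quasi-Polish if it is countably based and its topology is induced by a complete quasi-metric. *)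

(* Defs.v *)
From Stdlib Require Import Reals.
Open Scope R_scope.

Definition subset {X : Type} (A B : X -> Prop) : Prop := forall x, A x -> B x.

Definition is_topology {X : Type} (tau : (X -> Prop) -> Prop) : Prop :=
  tau (fun _ => True) /\
  tau (fun _ => False) /\
  (forall U V, tau U -> tau V -> tau (fun x => U x /\ V x)) /\
  (forall F : (X -> Prop) -> Prop, (forall U, F U -> tau U) ->
     tau (fun x => exists U, F U /\ U x)).

Definition generated_topology {X : Type} (S : (X -> Prop) -> Prop)
  : (X -> Prop) -> Prop :=
  fun U => forall tau, is_topology tau -> (forall V, S V -> tau V) -> tau U.

Definition same_topology {X : Type} (t1 t2 : (X -> Prop) -> Prop) : Prop :=
  forall U, t1 U <-> t2 U.

Definition countably_based {X : Type} (tau : (X -> Prop) -> Prop) : Prop :=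
  exists B : nat -> (X -> Prop),
    (forall n, tau (B n)) /\
    (forall U, tau U -> forall x, U x -> exists n, B n x /\ subset (B n) U).

Definition is_quasi_metric {X : Type} (d : X -> X -> R) : Prop :=
  (forall x y, 0 <= d x y) /\
  (forall x y, x = y <-> (d x y = 0 /\ d y x = 0)) /\
  (forall x y z, d x z <= d x y + d y z).

Definition is_metric {X : Type} (d : X -> X -> R) : Prop :=
  (forall x y, 0 <= d x y) /\
  (forall x y, d x y = 0 <-> x = y) /\
  (forall x y, d x y = d y x) /\
  (forall x y z, d x z <= d x y + d y z).

Definition ball {X : Type} (d : X -> X -> R) (x : X) (eps : R) : X -> Prop :=
  fun y => d x y < eps.

Definition induced_topology {X : Type} (d : X -> X -> R) : (X -> Prop) -> Prop :=
  generated_topology (fun B => exists x eps, B = ball d x eps).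

Definition dhat {X : Type} (d : X -> X -> R) : X -> X -> R :=
  fun x y => Rmax (d x y) (d y x).

Definition cauchy {X : Type} (d : X -> X -> R) (u : nat -> X) : Prop :=
  forall eps, 0 < eps -> exists n0 : nat,
    forall n m : nat, (n0 <= n)%nat -> (n <= m)%nat -> d (u n) (u m) < eps.

Definition converges_in {X : Type} (tau : (X -> Prop) -> Prop) (u : nat -> X) (x : X)
  : Prop :=
  forall U, tau U -> U x -> exists N : nat, forall n, (N <= n)%nat -> U (u n).

Definition complete_qm {X : Type} (d : X -> X -> R) : Prop :=
  forall u : nat -> X, cauchy d u ->
    exists x, converges_in (induced_topology (dhat d)) u x.

Definition quasi_Polish {X : Type} (tau : (X -> Prop) -> Prop) : Prop :=
  countably_based tau /\
  exists d, is_quasi_metric d /\ complete_qm d /\ same_topology tau (induced_topology d).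

Definition countable_set {X : Type} (D : X -> Prop) : Prop :=
  exists f : X -> nat, forall x y, D x -> D y -> f x = f y -> x = y.

Definition separable {X : Type} (tau : (X -> Prop) -> Prop) : Prop :=
  exists D : X -> Prop, countable_set D /\
    (forall U, tau U -> (exists x, U x) -> exists x, U x /\ D x).

Definition metrizable {X : Type} (tau : (X -> Prop) -> Prop) : Prop :=
  exists d, is_metric d /\ same_topology tau (induced_topology d).

Definition completely_metrizable {X : Type} (tau : (X -> Prop) -> Prop) : Prop :=
  exists d, is_metric d /\ complete_qm d /\ same_topology tau (induced_topology d).

Definition Polish {X : Type} (tau : (X -> Prop) -> Prop) : Prop :=
  separable tau /\ completely_metrizable tau.

Definition Sigma02 {X : Type} (tau : (X -> Prop) -> Prop) (A : X -> Prop) : Prop :=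
  exists U V : nat -> (X -> Prop),
    (forall i, tau (U i)) /\ (forall i, tau (V i)) /\
    (forall x, A x <-> exists i, U i x /\ ~ V i x).

(* Main.v *)
(** Call a sequence [u] "deep" in [A] when some fixed-radius balls around its
    late terms lie in [A]; for a Cauchy sequence [u] this says that the point
    of the completion defined by [u] lies in the largest open extension of [A].

    A metric space is completely metrizable as soon as it has a sequence of
    open covers such that a Cauchy sequence that is deep in a member of each
    cover converges (Frolik).  With a complete quasi-metric for [tau] and a
    countable list [Q] of [tau]-open sets containing a base, one finds covers
    which force every such [u] to admit a point [x] with
    [x] in [Q k] iff [u] is deep in [Q k].  It remains to see that [u] tends to
    [x]: if [u] is deep in a small ball [W] contained in the closed ball [C],
    write the complement of [C] as the union of the [U j \ V j].  Were [x] in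
    [U j \ V j], then [u] would be deep in [W /\ U j], hence in [V j], so [x]
    would be in [V j] provided [V j] is in the list [Q]. *)

Require Import Defs.
From Stdlib Require Import Reals.
From Stdlib Require Import Lra Lia Arith Cantor.
From Stdlib Require Import Classical ClassicalEpsilon.
From Stdlib Require Import FunctionalExtensionality PropExtensionality.

(** * Topologies of quasi-metrics, and depth of sequences *)

Definition metric_open {X : Type} (d : X -> X -> R) (U : X -> Prop) : Prop :=
  forall x, U x -> exists eps, 0 < eps /\ subset (ball d x eps) U.

(** Assumes just the properties shared by a quasi-metric and its [dhat], so that it serves for
    both. *)
Lemma induced_topology_iff (X : Type) (d : X -> X -> R) :
  (forall x, d x x = 0) -> (forall x y z, d x z <= d x y + d y z) ->
  forall U, induced_topology d U <-> metric_open d U.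
Proof.
  intros dxx tri U; split.
  - intros H. apply H.
    + repeat split.
      * intros x _. exists 1. split; [lra|]. intros y _; exact I.
      * intros x [].
      * intros A B HA HB x [Ax Bx].
        destruct (HA x Ax) as (e & e0 & He), (HB x Bx) as (f & f0 & Hf).
        exists (Rmin e f). split; [apply Rmin_pos; assumption|].
        intros y Hy. unfold ball in Hy.
        pose proof (Rmin_l e f). pose proof (Rmin_r e f).
        split; [apply He | apply Hf]; unfold ball; lra.
      * intros F HF x (A & FA & Ax).
        destruct (HF A FA x Ax) as (e & e0 & He).
        exists e. split; [assumption|]. intros y Hy. exists A. auto.
    + intros V (x & e & ->) y Hy. unfold ball in Hy.
      exists (e - d x y). split; [lra|].
      intros z Hz. unfold ball in *. pose proof (tri x y z). lra.
  - intros HU tau (_ & _ & _ & Hunion) Hball.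
    replace U with (fun x => exists V, ((exists y e, V = ball d y e) /\ subset V U) /\ V x).
    + apply Hunion. intros V [HV _]. auto.
    + apply functional_extensionality; intros x.
      apply propositional_extensionality; split.
      * intros (V & [_ VU] & Vx). auto.
      * intros Ux. destruct (HU x Ux) as (e & e0 & He).
        exists (ball d x e). split; [eauto|].
        unfold ball. rewrite dxx. assumption.
Qed.

Lemma quasi_metric_self (X : Type) (d : X -> X -> R) :
  is_quasi_metric d -> forall x, d x x = 0.
Proof. intros (_ & H & _) x. destruct (proj1 (H x x) eq_refl). assumption. Qed.

Lemma metric_quasi_metric (X : Type) (d : X -> X -> R) :
  is_metric d -> is_quasi_metric d.
Proof.
  intros (pos & eq0 & sym & tri). split; [assumption|]. split; [|assumption].
  intros x y. rewrite eq0, (eq0 y x). intuition.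
Qed.

Lemma induced_topology_open (X : Type) (d : X -> X -> R) :
  is_quasi_metric d -> forall U, induced_topology d U <-> metric_open d U.
Proof.
  intros Hd. apply induced_topology_iff.
  - apply quasi_metric_self; assumption.
  - apply Hd.
Qed.

Lemma metric_open_ball (X : Type) (d : X -> X -> R) (x : X) (r : R) :
  is_quasi_metric d -> metric_open d (ball d x r).
Proof.
  intros Hd. apply (proj1 (induced_topology_open X d Hd _)).
  intros tau _ H. apply H. eauto.
Qed.

Lemma dhat_triangle (X : Type) (d : X -> X -> R) :
  is_quasi_metric d -> forall x y z, dhat d x z <= dhat d x y + dhat d y z.
Proof.
  intros (_ & _ & tri) x y z. unfold dhat.
  pose proof (tri x y z). pose proof (tri z y x).
  pose proof (Rmax_l (d x y) (d y x)). pose proof (Rmax_r (d x y) (d y x)).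
  pose proof (Rmax_l (d y z) (d z y)). pose proof (Rmax_r (d y z) (d z y)).
  apply Rmax_lub; lra.
Qed.

Lemma dhat_self (X : Type) (d : X -> X -> R) :
  is_quasi_metric d -> forall x, dhat d x x = 0.
Proof.
  intros Hd x. unfold dhat. rewrite (quasi_metric_self X d Hd).
  apply Rmax_left. lra.
Qed.

Lemma converges_dhat_iff (X : Type) (d : X -> X -> R) (u : nat -> X) (x : X) :
  is_quasi_metric d ->
  converges_in (induced_topology (dhat d)) u x <->
  (forall eps, 0 < eps -> exists N, forall n, (N <= n)%nat ->
     d x (u n) < eps /\ d (u n) x < eps).
Proof.
  intros Hd.
  pose proof (induced_topology_iff X (dhat d) (dhat_self X d Hd) (dhat_triangle X d Hd))
    as Hopen.
  split.
  - intros H eps e0.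
    destruct (H (ball (dhat d) x eps)) as [N HN].
    + intros tau _ Hb. apply Hb. eauto.
    + unfold ball. rewrite (dhat_self X d Hd); assumption.
    + exists N. intros n Hn. specialize (HN n Hn). unfold ball, dhat in HN.
      apply Rmax_Rlt in HN. assumption.
  - intros H U HU Ux.
    destruct (proj1 (Hopen U) HU x Ux) as (e & e0 & He).
    destruct (H e e0) as [N HN]. exists N. intros n Hn.
    apply He. unfold ball, dhat. apply Rmax_Rlt. auto.
Qed.

Lemma inv_succ_pos (n : nat) : 0 < / (INR n + 1).
Proof. apply Rinv_0_lt_compat. pose proof (pos_INR n). lra. Qed.

Lemma inv_succ_lt (eps : R) :
  0 < eps -> exists N, forall n, (N <= n)%nat -> / (INR n + 1) < eps.
Proof.
  intros e0. destruct (archimed_cor1 eps e0) as (N & HN & N0).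
  exists N. intros n Hn. apply Rlt_trans with (/ INR N); [|assumption].
  apply lt_INR in N0. apply le_INR in Hn. simpl in N0.
  apply Rinv_lt_contravar; [apply Rmult_lt_0_compat|]; lra.
Qed.

Definition deep {X : Type} (rho : X -> X -> R) (u : nat -> X) (A : X -> Prop) : Prop :=
  exists eps, 0 < eps /\ exists K, forall k, (K <= k)%nat -> subset (ball rho (u k) eps) A.

Lemma deep_subset (X : Type) (rho : X -> X -> R) (u : nat -> X) (A B : X -> Prop) :
  subset A B -> deep rho u A -> deep rho u B.
Proof.
  intros AB (e & e0 & K & H). exists e. split; [assumption|].
  exists K. intros k Hk z Hz. apply AB, (H k Hk z Hz).
Qed.

Lemma deep_inter (X : Type) (rho : X -> X -> R) (u : nat -> X) (A B : X -> Prop) :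
  deep rho u A -> deep rho u B -> deep rho u (fun x => A x /\ B x).
Proof.
  intros (e & e0 & K & H) (f & f0 & L & H').
  exists (Rmin e f). split; [apply Rmin_pos; assumption|].
  exists (max K L). intros k Hk z Hz. unfold ball in Hz.
  pose proof (Rmin_l e f). pose proof (Rmin_r e f).
  split; [apply (H k) | apply (H' k)]; try lia; unfold ball; lra.
Qed.

(** * Complete sequences of covers *)

Section PerturbedMetric.

Variables (X : Type) (rho : X -> X -> R) (g : nat -> X -> R).
Hypothesis rho_metric : is_metric rho.

(** The cap bounds the supremum over [n] and makes all but finitely many gaps uniformly small, which
    keeps the supremum continuous. *)
Definition gap (n : nat) (x y : X) : R := Rmin (/ (INR n + 1)) (Rabs (g n x - g n y)).

Lemma gap_ge0 n x y : 0 <= gap n x y.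
Proof.
  unfold gap. pose proof (inv_succ_pos n). pose proof (Rabs_pos (g n x - g n y)).
  apply Rmin_glb; lra.
Qed.

Lemma gap_triangle n x y z : gap n x z <= gap n x y + gap n y z.
Proof.
  pose proof (gap_ge0 n x y). pose proof (gap_ge0 n y z). revert H H0.
  unfold gap. pose proof (inv_succ_pos n).
  pose proof (Rabs_triang (g n x - g n y) (g n y - g n z)).
  replace (g n x - g n y + (g n y - g n z)) with (g n x - g n z) in H0 by ring.
  unfold Rmin. repeat destruct Rle_dec; lra.
Qed.

Lemma gap_lub x y : {s | is_lub (fun r => exists n, r = gap n x y) s}.
Proof.
  apply completeness.
  - exists 1. intros r (n & ->). unfold gap.
    apply Rle_trans with (/ (INR n + 1)); [apply Rmin_l|].
    rewrite <- Rinv_1. apply Rinv_le_contravar; [lra|].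
    pose proof (pos_INR n). lra.
  - exists (gap 0 x y). eauto.
Qed.

Definition sup_gap (x y : X) : R := proj1_sig (gap_lub x y).

Lemma gap_le_sup n x y : gap n x y <= sup_gap x y.
Proof. apply (proj1 (proj2_sig (gap_lub x y))). eauto. Qed.

Lemma sup_gap_le x y M : (forall n, gap n x y <= M) -> sup_gap x y <= M.
Proof.
  intros H. apply (proj2 (proj2_sig (gap_lub x y))).
  intros r (n & ->). apply H.
Qed.

(** This is the remetrization used to show that a G-delta subset of a complete metric space is
    completely metrizable: along a [perturbed]-Cauchy sequence every [g n] is Cauchy, so a [g n]
    that blows up excludes unwanted limits. *)
Definition perturbed (x y : X) : R := rho x y + sup_gap x y.

Lemma sup_gap_ge0 x y : 0 <= sup_gap x y.
Proof. pose proof (gap_le_sup 0 x y). pose proof (gap_ge0 0 x y). lra. Qed.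

Lemma perturbed_metric : is_metric perturbed.
Proof.
  destruct rho_metric as (pos & eq0 & sym & tri). unfold perturbed.
  split; [|split; [|split]].
  - intros x y. pose proof (pos x y). pose proof (sup_gap_ge0 x y). lra.
  - intros x y. split.
    + intros H. pose proof (pos x y). pose proof (sup_gap_ge0 x y).
      apply eq0. lra.
    + intros <-. rewrite (proj2 (eq0 x x) eq_refl).
      assert (sup_gap x x <= 0).
      { apply sup_gap_le. intros n. unfold gap.
        replace (g n x - g n x) with 0 by ring. rewrite Rabs_R0. apply Rmin_r. }
      pose proof (sup_gap_ge0 x x). lra.
  - assert (le : forall x y, sup_gap x y <= sup_gap y x).
    { intros x y. apply sup_gap_le. intros n.
      pose proof (gap_le_sup n y x). unfold gap in *.
      rewrite Rabs_minus_sym. assumption. }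
    intros x y. rewrite sym. pose proof (le x y). pose proof (le y x). lra.
  - intros x y z. pose proof (tri x y z).
    assert (sup_gap x z <= sup_gap x y + sup_gap y z).
    { apply sup_gap_le. intros n. pose proof (gap_triangle n x y z).
      pose proof (gap_le_sup n x y). pose proof (gap_le_sup n y z). lra. }
    lra.
Qed.

(** From some index on, the cap alone keeps the gaps below [eps / 3]; the finitely many earlier gaps
    are controlled by continuity of each [g n]. *)
Lemma perturbed_continuous :
  (forall n x eps, 0 < eps -> exists del, 0 < del /\
     forall y, rho x y < del -> Rabs (g n x - g n y) < eps) ->
  forall x eps, 0 < eps -> exists del, 0 < del /\
    forall y, rho x y < del -> perturbed x y < eps.
Proof.
  intros cont x eps e0.
  destruct (inv_succ_lt (eps / 3)) as [N HN]; [lra|].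
  assert (initial : forall M, exists del, 0 < del /\ forall y, rho x y < del ->
            forall n, (n < M)%nat -> Rabs (g n x - g n y) < eps / 3).
  { induction M as [|M (a & a0 & Ha)].
    - exists 1. split; [lra|]. intros; lia.
    - destruct (cont M x (eps / 3)) as (b & b0 & Hb); [lra|].
      exists (Rmin a b). split; [apply Rmin_pos; assumption|].
      intros y Hy n Hn. pose proof (Rmin_l a b). pose proof (Rmin_r a b).
      destruct (Nat.eq_dec n M) as [->|]; [apply Hb; lra|].
      apply Ha; [lra|lia]. }
  destruct (initial N) as (a & a0 & Ha).
  exists (Rmin a (eps / 3)). split; [apply Rmin_pos; lra|].
  intros y Hy. pose proof (Rmin_l a (eps / 3)). pose proof (Rmin_r a (eps / 3)).
  assert (sup_gap x y <= eps / 3).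
  { apply sup_gap_le. intros n. unfold gap.
    destruct (le_lt_dec N n) as [Hn|Hn].
    - specialize (HN n Hn). eapply Rle_trans; [apply Rmin_l|]. lra.
    - eapply Rle_trans; [apply Rmin_r|]. apply Rlt_le, Ha; [lra|assumption]. }
  unfold perturbed. lra.
Qed.

Lemma perturbed_cauchy (u : nat -> X) :
  cauchy perturbed u -> cauchy rho u /\ forall n, cauchy (fun x y => Rabs (g n x - g n y)) u.
Proof.
  intros H. split.
  - intros eps e0. destruct (H eps e0) as [N HN]. exists N. intros n m Hn Hm.
    specialize (HN n m Hn Hm). unfold perturbed in HN.
    pose proof (sup_gap_ge0 (u n) (u m)). lra.
  - intros i eps e0. pose proof (inv_succ_pos i).
    (* A gap strictly below its cap equals the difference of the values of [g i]. *)
    destruct (H (Rmin eps (/ (INR i + 1)))) as [N HN]; [apply Rmin_pos; lra|].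
    exists N. intros n m Hn Hm. specialize (HN n m Hn Hm). unfold perturbed in HN.
    pose proof (proj1 rho_metric (u n) (u m)).
    pose proof (gap_le_sup i (u n) (u m)) as Hi. revert Hi HN. unfold gap, Rmin.
    repeat destruct Rle_dec; lra.
Qed.

End PerturbedMetric.

Section CompleteCovers.

Variables (X : Type) (rho : X -> X -> R) (G : nat -> (X -> Prop) -> Prop).
Hypothesis rho_metric : is_metric rho.
Hypothesis G_cover :
  forall n x, exists A, G n A /\ exists eps, 0 < eps /\ subset (ball rho x eps) A.

Definition inner_radius (n : nat) (x : X) (r : R) : Prop :=
  r <= 1 /\ exists A, G n A /\ subset (ball rho x r) A.

Lemma inner_radius_lub n x : {s | is_lub (inner_radius n x) s}.
Proof.
  apply completeness.
  - exists 1. intros r [H _]. assumption.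
  - destruct (G_cover n x) as (A & GA & e & e0 & H). exists (Rmin 1 e).
    split; [apply Rmin_l|]. exists A. split; [assumption|].
    intros z Hz. apply H. unfold ball in *. pose proof (Rmin_r 1 e). lra.
Qed.

Definition depth (n : nat) (x : X) : R := proj1_sig (inner_radius_lub n x).

Lemma depth_ge n x r : inner_radius n x r -> r <= depth n x.
Proof. apply (proj1 (proj2_sig (inner_radius_lub n x))). Qed.

Lemma depth_le n x M : (forall r, inner_radius n x r -> r <= M) -> depth n x <= M.
Proof. exact (proj2 (proj2_sig (inner_radius_lub n x)) M). Qed.

Lemma depth_pos n x : 0 < depth n x.
Proof.
  destruct (G_cover n x) as (A & GA & e & e0 & H).
  apply Rlt_le_trans with (Rmin 1 e); [apply Rmin_pos; lra|].
  apply depth_ge. split; [apply Rmin_l|]. exists A. split; [assumption|].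
  intros z Hz. apply H. unfold ball in *. pose proof (Rmin_r 1 e). lra.
Qed.

Lemma depth_lipschitz n x y : depth n x <= depth n y + rho x y.
Proof.
  destruct rho_metric as (pos & eq0 & sym & tri).
  apply depth_le. intros r (r1 & A & GA & H).
  enough (r - rho x y <= depth n y) by lra.
  apply depth_ge. pose proof (pos x y). split; [lra|].
  exists A. split; [assumption|]. intros z Hz. apply H. unfold ball in *.
  pose proof (tri x y z). lra.
Qed.

Lemma inv_depth_continuous n x eps :
  0 < eps -> exists del, 0 < del /\
    forall y, rho x y < del -> Rabs (/ depth n x - / depth n y) < eps.
Proof.
  intros e0. pose proof (depth_pos n x) as p.
  set (a := depth n x) in *.
  (* The first bound yields [b > a / 2] for the depth [b] at [y]; then the second yields
     [|b - a| < eps * (a * b)]. *)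
  exists (Rmin (a / 2) (eps * a * a / 2)).
  assert (0 < eps * a * a / 2) by (repeat apply Rmult_lt_0_compat; lra).
  split; [apply Rmin_pos; lra|]. intros y Hy.
  pose proof (Rmin_l (a / 2) (eps * a * a / 2)).
  pose proof (Rmin_r (a / 2) (eps * a * a / 2)).
  pose proof (depth_lipschitz n x y) as L1. pose proof (depth_lipschitz n y x) as L2.
  rewrite (proj1 (proj2 (proj2 rho_metric)) y x) in L2.
  fold a in L1, L2. set (b := depth n y) in *.
  assert (a / 2 < b) by lra.
  replace (/ a - / b) with ((b - a) * / (a * b)) by (field; lra).
  assert (0 < a * b) by (apply Rmult_lt_0_compat; lra).
  rewrite Rabs_mult, (Rabs_pos_eq (/ (a * b))) by (apply Rlt_le, Rinv_0_lt_compat; assumption).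
  apply Rmult_lt_reg_r with (a * b); [assumption|].
  rewrite Rmult_assoc, Rinv_l, Rmult_1_r by lra.
  assert (Rabs (b - a) <= rho x y) by (apply Rabs_le; lra).
  assert (eps * a * a / 2 < eps * (a * b)).
  { replace (eps * a * a / 2) with ((eps * a) * (a / 2)) by field.
    rewrite <- Rmult_assoc. apply Rmult_lt_compat_l; [apply Rmult_lt_0_compat|]; assumption. }
  lra.
Qed.

(** A Cauchy sequence of inverse depths is bounded by some [M] on a tail, so the depth exceeds [/ M]
    there. A member containing a ball of radius above [/ M] around one late term contains the balls
    of half that size, [/ M / 2], around all later terms. *)
Lemma inv_depth_cauchy_deep n (u : nat -> X) :
  cauchy rho u -> cauchy (fun x y => Rabs (/ depth n x - / depth n y)) u ->
  exists A, G n A /\ deep rho u A.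
Proof.
  intros Hu Hn. destruct rho_metric as (pos & eq0 & sym & tri).
  destruct (Hn 1) as [N HN]; [lra|].
  pose proof (depth_pos n (u N)) as p. pose proof (Rinv_0_lt_compat _ p) as ip.
  set (M := / depth n (u N) + 1) in *.
  assert (M0 : 0 < / M) by (apply Rinv_0_lt_compat; unfold M; lra).
  assert (low : forall k, (N <= k)%nat -> / M < depth n (u k)).
  { intros k Hk. specialize (HN N k (le_n N) Hk). apply Rabs_def2 in HN.
    pose proof (depth_pos n (u k)) as pk.
    rewrite <- (Rinv_inv (depth n (u k))). pose proof (Rinv_0_lt_compat _ pk).
    apply Rinv_lt_contravar; [apply Rmult_lt_0_compat|]; unfold M; lra. }
  destruct (Hu (/ M / 2)) as [K HK]; [lra|].
  set (L := max N K).
  assert (exists r, inner_radius n (u L) r /\ / M < r) as (r & (_ & A & GA & H) & Hr).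
  { apply NNPP. intros no.
    assert (depth n (u L) <= / M).
    { apply depth_le. intros r Hr. apply Rnot_lt_le. intros lt. apply no. eauto. }
    pose proof (low L (Nat.le_max_l N K)). lra. }
  exists A. split; [assumption|]. exists (/ M / 2). split; [lra|].
  exists L. intros k Hk z Hz. apply H. unfold ball in *.
  specialize (HK L k (Nat.le_max_r N K) Hk). pose proof (tri (u L) (u k) z). lra.
Qed.

(** Perturbing [rho] by the inverse depths makes each Cauchy sequence deep in a member of every
    cover, hence [rho]-convergent. Continuity of the new metric turns this into convergence for it
    and shows that the topology is unchanged. *)
Lemma complete_covers_completely_metrizable :
  (forall u, cauchy rho u -> (forall n, exists A, G n A /\ deep rho u A) ->
     exists x, forall eps, 0 < eps -> exists N, forall n, (N <= n)%nat -> rho x (u n) < eps) ->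
  completely_metrizable (induced_topology rho).
Proof.
  intros Hconv.
  set (d := perturbed X rho (fun n x => / depth n x)).
  assert (Hd : is_metric d) by (apply perturbed_metric, rho_metric).
  assert (cont : forall x eps, 0 < eps -> exists del, 0 < del /\
            forall y, rho x y < del -> d x y < eps)
    by (apply perturbed_continuous, inv_depth_continuous).
  exists d. split; [assumption|]. split.
  - intros u Hu. apply perturbed_cauchy in Hu; [|assumption].
    destruct Hu as [Hrho Hg].
    destruct (Hconv u Hrho) as [x Hx].
    { intros n. apply inv_depth_cauchy_deep; [assumption|apply Hg]. }
    exists x. apply converges_dhat_iff; [apply metric_quasi_metric; assumption|].
    intros eps e0. destruct (cont x eps e0) as (del & d0 & Hdel).
    destruct (Hx del d0) as [N HN]. exists N. intros n Hn.
    rewrite (proj1 (proj2 (proj2 Hd)) (u n) x). auto.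
  - intros U.
    rewrite !induced_topology_open by (apply metric_quasi_metric; assumption).
    split; intros HU x Ux; destruct (HU x Ux) as (e & e0 & He).
    + exists e. split; [assumption|]. intros y Hy. apply He. unfold ball in *.
      pose proof (sup_gap_ge0 X (fun n x => / depth n x) x y).
      unfold d, perturbed in Hy. lra.
    + destruct (cont x e e0) as (del & d0 & Hdel). exists del.
      split; [assumption|]. intros y Hy. apply He, Hdel, Hy.
Qed.

End CompleteCovers.

(** * Covers from a complete quasi-metric *)

Section QuasiMetricCovers.

Variables (X : Type) (d rho : X -> X -> R) (Q : nat -> X -> Prop).
Hypothesis d_quasi_metric : is_quasi_metric d.
Hypothesis d_complete : complete_qm d.
Hypothesis rho_metric : is_metric rho.
Hypothesis rho_finer : forall U, metric_open d U -> metric_open rho U.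
Hypothesis Q_open : forall k, metric_open d (Q k).
Hypothesis Q_base :
  forall U, metric_open d U -> forall x, U x -> exists k, Q k x /\ subset (Q k) U.
Hypothesis Q_total : forall x, Q 0%nat x.

(** [i] is the set reached so far, [m] a further set to enter, [j] the next set. Halving the radius
    leaves slack: a [dhat]-limit of points of [Q j] still lies in [ball d b r]. *)
Definition shrinking (i m l j : nat) (b : X) (r : R) : Prop :=
  0 < r <= / (INR l + 1) /\ subset (ball d b r) (Q i) /\ subset (ball d b r) (Q m) /\
  subset (Q j) (ball d b (r / 2)).

(** The second kind of member makes these covers of the whole space: a sequence
    deep in [Q i /\ Q m] is not deep in such a member once [l] is large. *)
Definition shrinking_cover (n : nat) (A : X -> Prop) : Prop :=
  let (p, l) := of_nat n in
  let (i, m) := of_nat p in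
  (exists j b r, shrinking i m l j b r /\ A = Q j) \/
  (forall z, A z -> exists w, ~ (Q i w /\ Q m w) /\ rho z w < / (INR l + 1)).

Lemma shrinking_cover_covers n x :
  exists A, shrinking_cover n A /\ exists eps, 0 < eps /\ subset (ball rho x eps) A.
Proof.
  unfold shrinking_cover. destruct (of_nat n) as [p l]. destruct (of_nat p) as [i m].
  pose proof (inv_succ_pos l).
  destruct (classic (Q i x /\ Q m x)) as [[Qi Qm]|nQ].
  - destruct (Q_open i x Qi) as (e & e0 & He), (Q_open m x Qm) as (f & f0 & Hf).
    set (r := Rmin (Rmin e f) (/ (INR l + 1))).
    assert (r0 : 0 < r) by (repeat apply Rmin_pos; assumption).
    assert (rl : r <= / (INR l + 1)) by apply Rmin_r.
    assert (r <= Rmin e f) by apply Rmin_l.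
    pose proof (Rmin_l e f). pose proof (Rmin_r e f).
    destruct (Q_base (ball d x (r / 2))) with (x := x) as (j & Qj & Hj).
    { apply metric_open_ball, d_quasi_metric. }
    { unfold ball. rewrite (quasi_metric_self X d d_quasi_metric). lra. }
    exists (Q j). split.
    + left. exists j, x, r. repeat split; auto.
      * intros z Hz. apply He. unfold ball in *. lra.
      * intros z Hz. apply Hf. unfold ball in *. lra.
    + apply (rho_finer _ (Q_open j)). assumption.
  - exists (ball rho x (/ (INR l + 1) / 2)). split.
    + right. intros z Hz. exists x. split; [assumption|]. unfold ball in Hz.
      rewrite (proj1 (proj2 (proj2 rho_metric)) z x). lra.
    + exists (/ (INR l + 1) / 2). split; [lra|]. intros z Hz. exact Hz.
Qed.

Variable u : nat -> X.
Hypothesis u_covered : forall n, exists A, shrinking_cover n A /\ deep rho u A.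

Lemma deep_shrinking i m n :
  deep rho u (Q i) -> deep rho u (Q m) ->
  exists j b r, deep rho u (Q j) /\ shrinking i m n j b r.
Proof.
  intros Hi Hm. destruct (deep_inter X rho u _ _ Hi Hm) as (e & e0 & K & HK).
  destruct (inv_succ_lt e e0) as [N HN].
  (* [l >= n] keeps the requested bound on the radius; [l >= N] makes [/ (INR l + 1) < e], which
     excludes members of the second kind. *)
  set (l := max n N).
  destruct (u_covered (to_nat (to_nat (i, m), l))) as (A & HA & HuA).
  unfold shrinking_cover in HA. rewrite !cancel_of_to in HA.
  destruct HA as [(j & b & r & Hs & ->)|Hfar].
  - exists j, b, r. split; [assumption|]. destruct Hs as ([r0 rl] & Hs).
    split; [|assumption]. split; [assumption|].
    apply Rle_trans with (1 := rl). pose proof (pos_INR n).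
    apply Rinv_le_contravar; [lra|].
    apply Rplus_le_compat_r, le_INR, Nat.le_max_l.
  - exfalso. destruct HuA as (f & f0 & L & HL).
    set (k := max K L).
    destruct (Hfar (u k)) as (w & nw & Hw).
    { apply (HL k); [apply Nat.le_max_r|]. unfold ball.
      rewrite (proj2 (proj1 (proj2 rho_metric) (u k) (u k)) eq_refl). assumption. }
    apply nw, (HK k); [apply Nat.le_max_l|].
    specialize (HN l (Nat.le_max_r n N)). unfold ball. lra.
Qed.

Lemma deep_total : deep rho u (Q 0%nat).
Proof.
  exists 1. split; [lra|]. exists 0%nat. intros k _ z _. apply Q_total.
Qed.

(** Dependent choice: stage [k] enters [Q k] if [u] is deep in it, and otherwise merely [Q 0], the
    whole space. Thus every [Q k] in which [u] is deep gets its turn. *)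
Lemma shrinking_sequence :
  exists (s : nat -> nat) (b : nat -> X) (r : nat -> R), forall k,
    deep rho u (Q (s k)) /\ (deep rho u (Q k) -> subset (ball d (b k) (r k)) (Q k)) /\
    shrinking (s k) 0 k (s (S k)) (b k) (r k).
Proof.
  assert (step : forall k i, exists t : nat * X * R, deep rho u (Q i) ->
            let '(j, b, r) := t in
            deep rho u (Q j) /\ (deep rho u (Q k) -> subset (ball d b r) (Q k)) /\
            shrinking i 0 k j b r).
  { intros k i. destruct (classic (deep rho u (Q i))) as [Hi|Hi].
    - destruct (classic (deep rho u (Q k))) as [Hk|Hk].
      + destruct (deep_shrinking i k k Hi Hk) as (j & b & r & Hj & Hs).
        exists (j, b, r). intros _. unfold shrinking in *. repeat split; try tauto.
        intros z _. apply Q_total.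
      + destruct (deep_shrinking i 0 k Hi deep_total) as (j & b & r & Hj & Hs).
        exists (j, b, r). tauto.
    (* A dummy triple makes the choice function [F] total. *)
    - exists (0%nat, u 0%nat, 0). tauto. }
  set (F := fun k i => proj1_sig (constructive_indefinite_description _ (step k i))).
  set (s := fix s k := match k with O => 0%nat | S k => fst (fst (F k (s k))) end).
  assert (HF : forall k i, deep rho u (Q i) ->
            deep rho u (Q (fst (fst (F k i)))) /\
            (deep rho u (Q k) -> subset (ball d (snd (fst (F k i))) (snd (F k i))) (Q k)) /\
            shrinking i 0 k (fst (fst (F k i))) (snd (fst (F k i))) (snd (F k i))).
  { intros k i Hi. unfold F.
    destruct constructive_indefinite_description as [[[j b] r] Ht]. exact (Ht Hi). }
  assert (Hs : forall k, deep rho u (Q (s k))).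
  { induction k as [|k IH]; [exact deep_total|]. apply (HF k (s k) IH). }
  exists s, (fun k => snd (fst (F k (s k)))), (fun k => snd (F k (s k))).
  intros k. split; [apply Hs|]. apply (HF k (s k) (Hs k)).
Qed.

(** The point is the [dhat]-limit of the centres [b k]. Smallness of [d x (b m)] puts a late
    [Q (s (S m))] inside any open set around [x]; smallness of [d (b m) x] keeps [x] in each
    [ball d (b k) (r k)]. *)
Lemma deep_point : exists x, forall k, Q k x <-> deep rho u (Q k).
Proof.
  destruct shrinking_sequence as (s & b & r & H).
  pose proof (proj2 (proj2 d_quasi_metric)) as tri.
  assert (r0 : forall k, 0 < r k) by (intros k; apply H).
  assert (rk : forall k, r k <= / (INR k + 1)) by (intros k; apply H).
  assert (half : forall k, subset (Q (s (S k))) (ball d (b k) (r k / 2))) by (intros k; apply H).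
  assert (inside : forall k, subset (ball d (b k) (r k)) (Q (s k))) by (intros k; apply H).
  assert (decr : forall k m, (k <= m)%nat -> subset (Q (s m)) (Q (s k))).
  { intros k m Hm. induction Hm as [|m Hm IH]; intros z Hz; [assumption|].
    apply IH, inside. apply half in Hz. unfold ball in *. pose proof (r0 m). lra. }
  assert (bQ : forall k, Q (s k) (b k)).
  { intros k. apply inside. unfold ball. rewrite (quasi_metric_self X d d_quasi_metric). apply r0. }
  assert (near : forall k m, (k < m)%nat -> d (b k) (b m) < r k / 2).
  { intros k m Hm. apply half, (decr (S k) m); [lia|apply bQ]. }
  destruct (d_complete b) as [x Hx].
  { intros eps e0. destruct (inv_succ_lt eps e0) as [N HN]. exists N. intros n m Hn Hm.
    pose proof (r0 n). pose proof (rk n). specialize (HN n Hn).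
    apply Nat.lt_eq_cases in Hm. destruct Hm as [Hm|<-].
    - pose proof (near n m Hm). lra.
    - rewrite (quasi_metric_self X d d_quasi_metric). lra. }
  rewrite converges_dhat_iff in Hx by assumption.
  exists x. intros k. split.
  - intros Qx. destruct (Q_open k x Qx) as (e & e0 & He).
    destruct (Hx (e / 2)) as [N HN]; [lra|].
    destruct (inv_succ_lt e e0) as [N' HN'].
    set (m := max N N').
    destruct (HN m (Nat.le_max_l N N')) as [Hxb _].
    specialize (HN' m (Nat.le_max_r N N')).
    apply deep_subset with (2 := proj1 (H (S m))).
    intros z Hz. apply He. apply half in Hz. unfold ball in *.
    pose proof (tri x (b m) z). pose proof (rk m). lra.
  - intros Hk. apply (proj1 (proj2 (H k)) Hk). unfold ball.
    destruct (Hx (r k / 2)) as [N HN]; [pose proof (r0 k); lra|].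
    (* For [m > k], the centre [b m] is within [r k / 2] of [b k]; the other half of the radius is
       spent on the passage to [x]. *)
    set (m := max N (S k)).
    destruct (HN m (Nat.le_max_l N (S k))) as [_ Hbx].
    pose proof (near k m (Nat.le_max_r N (S k))). pose proof (tri (b k) (b m) x). lra.
Qed.

End QuasiMetricCovers.

(** * Complete metrizability of the finer topology *)

Lemma completely_metrizable_same (X : Type) (t1 t2 : (X -> Prop) -> Prop) :
  same_topology t1 t2 -> completely_metrizable t2 -> completely_metrizable t1.
Proof.
  intros H (d & Hd & Hc & Ht). exists d. split; [assumption|]. split; [assumption|].
  intros U. rewrite (H U). apply Ht.
Qed.

Theorem theorem75 (X : Type) (tau tau' : (X -> Prop) -> Prop) :
  is_topology tau -> is_topology tau' ->
  quasi_Polish tau ->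
  separable tau' -> metrizable tau' ->
  (forall U, tau U -> tau' U) ->
  (forall U, tau' U -> Sigma02 tau U) ->
  Polish tau'.
Proof.
  intros Htau Htau' [[B [B_open B_base]] [d [Hd [d_complete d_top]]]] Hsep
    [rho [Hrho rho_top]] finer sigma.
  split; [assumption|].
  apply (completely_metrizable_same X _ _ rho_top).
  destruct Hsep as (D & [f f_inj] & D_dense).
  pose proof (metric_quasi_metric X rho Hrho) as Hrho'.
  destruct (Hrho) as (pos & eq0 & sym & tri).
  assert (tau_open : forall U, tau U <-> metric_open d U).
  { intros U. rewrite (d_top U). apply induced_topology_open, Hd. }
  assert (tau'_open : forall U, tau' U <-> metric_open rho U).
  { intros U. rewrite (rho_top U). apply induced_topology_open, Hrho'. }
  (* Indexing the balls around points of [D] by codes [f a] gives a countable family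
     even if [D] is empty; for a code of no point, [outside] is the whole space. *)
  set (outside := fun (p : nat * nat) (z : X) =>
         forall a, D a -> f a = fst p -> / (INR (snd p) + 1) < rho a z).
  assert (outside_sigma : forall p, Sigma02 tau (outside p)).
  { intros [q n]. apply sigma, tau'_open. unfold outside; simpl. intros z Hz.
    destruct (classic (exists a, D a /\ f a = q)) as [(a & Da & fa)|none].
    - exists (rho a z - / (INR n + 1)). split; [pose proof (Hz a Da fa); lra|].
      intros y Hy a' Da' fa'. rewrite <- (f_inj a a' Da Da') by congruence.
      unfold ball in Hy. pose proof (tri a y z). rewrite (sym y z) in *. lra.
    - exists 1. split; [lra|]. intros y _ a Da fa. exfalso; eauto. }
  (* [V] comes first because it alone is chosen uniformly in [p], to be listed in [Q]; the sets [U]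
     will be replaced by basic sets. *)
  assert (outside_diff : forall p, exists V U : nat -> X -> Prop,
            (forall i, tau (U i)) /\ (forall i, tau (V i)) /\
            forall x, outside p x <-> exists i, U i x /\ ~ V i x).
  { intros p. destruct (outside_sigma p) as (U & V & H). eauto. }
  set (V := fun p => proj1_sig (constructive_indefinite_description _ (outside_diff p))).
  assert (HV : forall p, exists U : nat -> X -> Prop,
            (forall i, tau (U i)) /\ (forall i, tau (V p i)) /\
            forall x, outside p x <-> exists i, U i x /\ ~ V p i x).
  { intros p. exact (proj2_sig (constructive_indefinite_description _ (outside_diff p))). }
  clearbody V.
  (* Row 0 puts the whole space at index 0, since [of_nat 0] is [(0, 0)]; row 1 is the base, and the
     later rows list the sets [V p m]. *)
  set (Q := fun n => match of_nat n with
              | (0, _) => fun _ : X => True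
              | (1, m) => B m
              | (S (S i), m) => V (of_nat i) m
              end%nat).
  assert (Q_open : forall k, metric_open d (Q k)).
  { intros k. apply tau_open. unfold Q. destruct (of_nat k) as [[|[|i]] m].
    - apply Htau.
    - apply B_open.
    - destruct (HV (of_nat i)) as (U & _ & H & _). apply H. }
  assert (Q_V : forall p i, exists k, Q k = V p i).
  { intros p i. exists (to_nat (S (S (to_nat p)), i)). unfold Q.
    rewrite cancel_of_to, cancel_of_to. reflexivity. }
  assert (Q_base : forall U, metric_open d U -> forall x, U x ->
            exists k, Q k x /\ subset (Q k) U).
  { intros U HU x Ux. destruct (B_base U (proj2 (tau_open U) HU) x Ux) as [n Hn].
    exists (to_nat (1%nat, n)). unfold Q. rewrite cancel_of_to. exact Hn. }
  assert (rho_finer : forall U, metric_open d U -> metric_open rho U).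
  { intros U HU. apply tau'_open, finer, tau_open, HU. }
  assert (Q_total : forall x, Q 0%nat x) by (intros x; exact I).
  apply complete_covers_completely_metrizable with (shrinking_cover X d rho Q);
    [assumption| |].
  { intros n x. apply shrinking_cover_covers; assumption. }
  intros u Hu Hcov.
  destruct (deep_point X d rho Q) with (u := u) as [x Hx]; try assumption.
  exists x. intros eps e0.
  destruct (inv_succ_lt (eps / 2)) as [n Hn]; [lra|]. specialize (Hn n (le_n n)).
  (* With [del < eps / 2], late terms within [2 * del / 3] of [a] and [rho a x <= del] add up to
     less than [eps]. The remaining [del / 3] is the radius for [a_deep]. *)
  set (del := / (INR n + 1)) in *.
  assert (d0 : 0 < del) by apply inv_succ_pos.
  destruct (Hu (del / 3)) as [N HN]; [lra|].
  destruct (D_dense (ball rho (u N) (del / 3))) as (a & Ha & Da).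
  { apply tau'_open, metric_open_ball, Hrho'. }
  { exists (u N). unfold ball. rewrite (proj2 (eq0 _ _) eq_refl). lra. }
  unfold ball in Ha. rewrite sym in Ha.
  assert (near : forall k, (N <= k)%nat -> rho a (u k) < 2 * del / 3).
  { intros k Hk. specialize (HN N k (le_n N) Hk). pose proof (tri a (u N) (u k)). lra. }
  assert (a_deep : deep rho u (ball rho a del)).
  { exists (del / 3). split; [lra|]. exists N. intros k Hk z Hz. unfold ball in *.
    specialize (near k Hk). pose proof (tri a (u k) z). lra. }
  assert (rho a x <= del).
  { apply Rnot_lt_le. intros far.
    destruct (HV (f a, n)) as (U & U_open & _ & HUV).
    destruct (proj1 (HUV x)) as (i & Ux & nVx).
    { intros a' Da' fa'. rewrite (f_inj a' a Da' Da fa'). exact far. }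
    apply nVx. destruct (Q_V (f a, n) i) as [k E]. rewrite <- E. apply Hx.
    (* [Hx] speaks only of listed sets, so [U i] is shrunk to a listed [Q l] around [x]. *)
    destruct (Q_base (U i)) with (x := x) as (l & Qx & QU); [apply tau_open; auto|assumption|].
    apply deep_subset with (2 := deep_inter X rho u _ _ a_deep (proj1 (Hx l) Qx)).
    intros z [az Qz]. apply NNPP. intros nQ.
    assert (out : outside (f a, n) z).
    { apply HUV. exists i. split; [apply QU, Qz|]. rewrite <- E. exact nQ. }
    pose proof (out a Da eq_refl) as far'. unfold ball in az. simpl in far'. fold del in far'. lra. }
  exists N. intros k Hk. specialize (near k Hk).
  pose proof (tri x a (u k)). rewrite (sym x a) in *. lra.
Qed.
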